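(* Let $\lambda$ be a nonzero real number. For every integer $m\ge 1$ and every real number $x$, as formal power series in $t$, $$e^{t}\,e^{x\left(\frac{e^{\lambda mt}-1}{\lambda m}\right)}=\sum_{n=0}^{\infty}d_{m,\lambda}(n,x)\frac{t^{n}}{n!}.$$
   Context: For a nonzero real $\lambda$, the generalized falling factorials are $(x)_{0,\lambda}=1$ and $(x)_{n,\lambda}=x(x-\lambda)\cdots(x-(n-1)\lambda)$ for $n\ge 1$. For an integer $m\ge 1$, the $\lambda$-analogues of the Whitney-type Stirling numbers of the second kind $W_{m,\lambda}(n,k)$ ($0\le k\le n$) are the real numbers uniquely determined by the polynomial identities in $x$ $$(mx+1)^{n}=\sum_{k=0}^{n}W_{m,\lambda}(n,k)m^{k}(x)_{k,\lambda},\quad n\ge 0.$$ The $\lambda$-analogues of Dowling polynomials are $d_{m,\lambda}(n,x)=\sum_{k=0}^{n}W_{m,\lambda}(n,k)x^{k}$ for $n\ge 0$. *)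

(* Defs.v *)
From HB Require Import structures.
From mathcomp Require Import all_boot all_order all_algebra.
From mathcomp Require Import boolp.
From mathcomp Require Export reals.

Set Implicit Arguments.
Unset Strict Implicit.
Unset Printing Implicit Defensive.

Import GRing.Theory Num.Theory.
Local Open Scope ring_scope.

(* A power series is the sequence of its coefficients. The wrapper keeps the   *)
(* Cauchy product apart from the pointwise product of functions nat -> R.      *)
Record fps (R : fieldType) := FPS { coefs :> nat -> R }.

Section FormalPowerSeries.
Variable R : fieldType.
Implicit Types f g h : fps R.

Lemma fpsP f g : (forall n, f n = g n) <-> f = g.
Proof.
split=> [|-> //]; case: f g => [f] [g] /= fg.
by congr FPS; apply: funext.
Qed.

HB.instance Definition _ := gen_eqMixin (fps R).
HB.instance Definition _ := gen_choiceMixin (fps R).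

Definition fps_add f g := FPS (fun n => f n + g n).
Definition fps_opp f := FPS (fun n => - f n).

Fact fps_addA : associative fps_add.
Proof. by move=> f g h; apply/fpsP => n /=; rewrite addrA. Qed.
Fact fps_addC : commutative fps_add.
Proof. by move=> f g; apply/fpsP => n /=; rewrite addrC. Qed.
Fact fps_add0 : left_id (FPS (fun=> 0)) fps_add.
Proof. by move=> f; apply/fpsP => n /=; rewrite add0r. Qed.
Fact fps_addN : left_inverse (FPS (fun=> 0)) fps_opp fps_add.
Proof. by move=> f; apply/fpsP => n /=; rewrite addNr. Qed.

HB.instance Definition _ :=
  GRing.isZmodule.Build (fps R) fps_addA fps_addC fps_add0 fps_addN.

Definition fps_one : fps R := FPS (fun n => (n == 0%N)%:R).
Definition fps_mul f g := FPS (fun n => \sum_(i < n.+1) f i * g (n - i)%N).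

Definition fps_trunc N f : {poly R} := \poly_(i < N.+1) f i.

Lemma fps_trunc_coef N f n : (n <= N)%N -> (fps_trunc N f)`_n = f n.
Proof. by move=> nN; rewrite coef_poly ltnS nN. Qed.

Lemma fps_trunc_mul N f g n : (n <= N)%N ->
  (fps_trunc N f * fps_trunc N g)`_n = fps_mul f g n.
Proof.
move=> nN; rewrite coefM; apply: eq_bigr => i _.
by rewrite !fps_trunc_coef // (leq_trans _ nN) ?leq_subr // -ltnS.
Qed.

Fact fps_mulC : commutative fps_mul.
Proof. by move=> f g; apply/fpsP => n; rewrite -!(@fps_trunc_mul n) // mulrC. Qed.

Fact fps_mulA : associative fps_mul.
Proof.
move=> f g h; apply/fpsP => n.
transitivity ((fps_trunc n f * (fps_trunc n g * fps_trunc n h))`_n).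
  rewrite coefM; apply: eq_bigr => i _.
  by rewrite fps_trunc_mul ?leq_subr // fps_trunc_coef // -ltnS.
rewrite mulrA coefM; apply: eq_bigr => i _.
by rewrite fps_trunc_mul ?fps_trunc_coef ?leq_subr // -ltnS.
Qed.

Fact fps_mul1 : left_id fps_one fps_mul.
Proof.
move=> f; apply/fpsP => n /=.
rewrite big_ord_recl /= subn0 mul1r big1 ?addr0 // => i _.
by rewrite mul0r.
Qed.

Fact fps_mulDl : left_distributive fps_mul fps_add.
Proof.
move=> f g h; apply/fpsP => n /=.
by rewrite -big_split; apply: eq_bigr => i _; rewrite mulrDl.
Qed.

Fact fps_one_neq0 : fps_one != 0.
Proof. by apply/eqP => /fpsP /(_ 0%N) /eqP; rewrite oner_eq0. Qed.

HB.instance Definition _ := GRing.Zmodule_isComNzRing.Build (fps R)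
  fps_mulA fps_mulC fps_mul1 fps_mulDl fps_one_neq0.

Definition fps_scale (a : R) f := FPS (fun n => a * f n).

Fact fps_scaleA a b f : fps_scale a (fps_scale b f) = fps_scale (a * b) f.
Proof. by apply/fpsP => n /=; rewrite mulrA. Qed.
Fact fps_scale1 : left_id 1 fps_scale.
Proof. by move=> f; apply/fpsP => n /=; rewrite mul1r. Qed.
Fact fps_scaleDr : right_distributive fps_scale +%R.
Proof. by move=> a f g; apply/fpsP => n /=; rewrite mulrDr. Qed.
Fact fps_scaleDl f : {morph fps_scale^~ f : a b / a + b}.
Proof. by move=> a b; apply/fpsP => n /=; rewrite mulrDl. Qed.

HB.instance Definition _ := GRing.Zmodule_isLmodule.Build R (fps R)
  fps_scaleA fps_scale1 fps_scaleDr fps_scaleDl.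

Lemma fps_coefM f g n : (f * g) n = \sum_(i < n.+1) f i * g (n - i)%N.
Proof. by []. Qed.

(* If f 0 = 0 then f ^+ k has no coefficient of index n < k, so cutting the    *)
(* substitution \sum_k g k *: f ^+ k at k = n leaves its n-th coefficient      *)
(* unchanged. The composite is meaningful only when f 0 = 0.                   *)
Definition fps_comp g f : fps R :=
  FPS (fun n => \sum_(k < n.+1) g k * (f ^+ k) n).

Lemma fps_coefX_lt f k n : f 0%N = 0 -> (n < k)%N -> (f ^+ k) n = 0.
Proof.
move=> f0; elim: k n => [//|k IHk] n nk; rewrite exprS fps_coefM big1 // => i _.
case: i => [[|i] /= lti]; first by rewrite f0 mul0r.
rewrite IHk ?mulr0 //; case: n lti nk => // n _ nk.
by rewrite subSS (leq_ltn_trans (leq_subr i n)).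
Qed.

(* The indeterminate t. *)
Definition fps_var : fps R := FPS (fun n => (n == 1%N)%:R).

(* \sum_n a n * t ^+ n / n! *)
Definition fps_egf (a : nat -> R) : fps R := FPS (fun n => a n / n`!%:R).

(* exp f, for f 0 = 0 *)
Definition fps_exp f : fps R := fps_comp (fps_egf (fun=> 1)) f.

End FormalPowerSeries.

Arguments fps_var {R}.

Section Whitney.
Variable R : realType.
Implicit Types (lambda x : R) (m n k : nat) (W : nat -> nat -> R).

(* The generalized falling factorial (x)_{n,lambda} as a polynomial in x. *)
Definition falling lambda n : {poly R} :=
  \prod_(i < n) ('X - (i%:R * lambda)%:P).

(* W n k is constrained for k <= n only; see whitney2_exists and               *)
(* whitney2_unique.                                                            *)
Definition is_whitney2 m lambda W : Prop := forall n,
  (m%:R *: 'X + 1) ^+ n =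
    \sum_(k < n.+1) (W n k * m%:R ^+ k) *: falling lambda k.

(* d_{m,lambda}(n, x), where W is the array W_{m,lambda} *)
Definition dowling W n x : R := \sum_(k < n.+1) W n k * x ^+ k.

Lemma falling_monic lambda n : falling lambda n \is monic.
Proof. by apply: monic_prod => i _; rewrite monicXsubC. Qed.

Lemma size_falling lambda n : size (falling lambda n) = n.+1.
Proof. by rewrite /falling size_prod_XsubC /= /index_enum -enumT size_enum_ord. Qed.

Lemma falling_span lambda n (p : {poly R}) : (size p <= n)%N ->
  exists c : nat -> R, p = \sum_(k < n) c k *: falling lambda k.
Proof.
elim: n p => [|n IHn] p szp.
  by exists (fun=> 0); rewrite big_ord0; apply/eqP; rewrite -size_poly_leq0.
have [|c cE] := IHn (p - p`_n *: falling lambda n).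
  apply/leq_sizeP => j; rewrite leq_eqVlt => /orP[/eqP <-|nj].
    have := falling_monic lambda n.
    rewrite monicE /lead_coef size_falling /= => /eqP fn.
    by rewrite coefB coefZ fn mulr1 subrr.
  rewrite coefB coefZ (nth_default _ (leq_trans szp nj)).
  by rewrite [(falling _ _)`_j]nth_default ?mulr0 ?subr0 ?size_falling.
exists (fun k => if k == n then p`_n else c k).
rewrite big_ord_recr /= eqxx -[LHS](subrK (p`_n *: falling lambda n)) cE.
by congr (_ + _); apply: eq_bigr => i _; rewrite ltn_eqF.
Qed.

Lemma falling_free lambda n (c : nat -> R) :
  \sum_(k < n) c k *: falling lambda k = 0 -> forall k, (k < n)%N -> c k = 0.
Proof.
elim: n => [//|n IHn]; rewrite big_ord_recr /= => s0.
have cn : c n = 0.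
  have := congr1 (fun p : {poly R} => p`_n) s0.
  rewrite coefD coef0 coef_sum big1 ?add0r => [|i _]; last first.
    by rewrite coefZ nth_default ?mulr0 // size_falling.
  have := falling_monic lambda n.
  by rewrite monicE /lead_coef size_falling coefZ /= => /eqP ->; rewrite mulr1.
move: s0; rewrite cn scale0r addr0 => s0 k; rewrite ltnS leq_eqVlt.
by case/orP => [/eqP -> //|]; apply: IHn.
Qed.

Lemma whitney2_exists m lambda : (1 <= m)%N -> exists W, is_whitney2 m lambda W.
Proof.
move=> m1; have m0 : m%:R != 0 :> R by rewrite pnatr_eq0 -lt0n.
have H n : exists c : nat -> R,
    (m%:R *: 'X + 1) ^+ n = \sum_(k < n.+1) c k *: falling lambda k.
  apply: falling_span; apply: leq_trans (size_poly_exp_leq _ _) _.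
  rewrite ltnS -[leqRHS]mul1n leq_mul2r; apply/orP; right.
  have: (size (m%:R *: 'X + 1 : {poly R})%R <= 2)%N.
    apply: leq_trans (size_polyD _ _) _; rewrite geq_max size_poly1 andbT.
    by rewrite (leq_trans (size_scale_leq _ _)) ?size_polyX.
  by case: size.
pose W n k := sval (cid (H n)) k / m%:R ^+ k.
exists W => n; rewrite [LHS](svalP (cid (H n))); apply: eq_bigr => k _.
by rewrite /W divfK // expf_neq0.
Qed.

Lemma whitney2_unique m lambda W1 W2 : (1 <= m)%N ->
  is_whitney2 m lambda W1 -> is_whitney2 m lambda W2 ->
  forall n k, (k <= n)%N -> W1 n k = W2 n k.
Proof.
move=> m1 w1 w2 n k kn; have m0 : m%:R != 0 :> R by rewrite pnatr_eq0 -lt0n.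
pose c i := W1 n i * m%:R ^+ i - W2 n i * m%:R ^+ i.
have /(@falling_free lambda n.+1 c)/(_ k) :
    \sum_(i < n.+1) c i *: falling lambda i = 0.
  under eq_bigr do rewrite scalerBl.
  by rewrite sumrB -w1 -w2 subrr.
rewrite ltnS => /(_ kn) /eqP; rewrite /c -mulrBl mulf_eq0 expf_eq0 (negPf m0).
by rewrite andbF orbF subr_eq0 => /eqP.
Qed.

End Whitney.

(* Main.v *)
Require Import Defs.
From mathcomp Require Import all_boot all_order all_algebra.
From mathcomp Require Import ring.
Local Open Scope ring_scope.

(* Put a = lambda m, u = (e^(a t) - 1) / a and c_k = e^t u^k / k!. As          *)
(* u' = 1 + a u, one has c_(k+1)' = c_k + (1 + (k+1) a) c_(k+1), so the        *)
(* numbers n! [t^n] c_k satisfy the recurrence that (m x + 1)^(n+1) =          *)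
(* (m x + 1) (m x + 1)^n imposes on W(n, k). Hence they are the W(n, k), and   *)
(* the left-hand side is \sum_k x^k c_k.                                       *)

Import GRing.Theory Num.Theory.

(** The recurrence on the series side, [whitney_egf_coef_recr], comes from u' = 1 + a u; the one on
    the polynomial side from (m x + 1) (x)_k = m (x)_(k+1) + (1 + k a) (x)_k. They meet in
    [whitney_egf_coefP]. Then [whitney2_unique] identifies the coefficients with W, and
    [fps_coef_expZ_mul] expands the left-hand side in powers of x. *)

Section Derivative.
Set Implicit Arguments.
Variable R : fieldType.
Implicit Types (f g : fps R) (a : R).

Definition fps_deriv f : fps R := FPS (fun n => n.+1%:R * f n.+1).

Lemma fps_coef_deriv f n : fps_deriv f n = n.+1%:R * f n.+1.
Proof. by []. Qed.

Lemma fps_coefD f g n : (f + g) n = f n + g n.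
Proof. by []. Qed.

Lemma fps_coefB f g n : (f - g) n = f n - g n.
Proof. by []. Qed.

Lemma fps_coefZ a f n : (a *: f) n = a * f n.
Proof. by []. Qed.

Lemma fps_coefMn f k n : (f *+ k) n = k%:R * f n.
Proof.
elim: k => [|k IHk]; first by rewrite mul0r.
by rewrite mulrS fps_coefD IHk -[k.+1]add1n natrD mulrDl mul1r.
Qed.

Lemma fps_coef1 n : (1 : fps R) n = (n == 0%N)%:R.
Proof. by []. Qed.

Lemma fps_scalerAl a f g : a *: (f * g) = (a *: f) * g.
Proof.
apply/fpsP => n; rewrite fps_coefZ !fps_coefM mulr_sumr.
by apply: eq_bigr => i _; rewrite fps_coefZ mulrA.
Qed.

Lemma fps_scalerAr a f g : a *: (f * g) = f * (a *: g).
Proof. by rewrite mulrC fps_scalerAl mulrC. Qed.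

Lemma fps_scaleX a f k : (a *: f) ^+ k = a ^+ k *: f ^+ k.
Proof.
elim: k => [|k IHk]; first by rewrite !expr0 scale1r.
by rewrite !exprS IHk -fps_scalerAl -fps_scalerAr scalerA.
Qed.

(** Inherited from polynomials: coefficient [n] of each side involves only coefficients of index at
    most [n.+1], so both series may be truncated there. *)
Lemma fps_derivM f g :
  fps_deriv (f * g) = fps_deriv f * g + f * fps_deriv g.
Proof.
apply/fpsP => n; transitivity (n.+1%:R * fps_mul f g n.+1) => //.
rewrite -(@fps_trunc_mul _ n.+1) // mulr_natl -coef_deriv derivM coefD.
have le_n_n1 k : (k <= n -> k <= n.+1)%N by move=> kn; rewrite ltnW.
congr (_ + _); rewrite coefM; apply: eq_bigr => i _.
  rewrite coef_deriv !fps_trunc_coef ?(ltn_ord i) ?le_n_n1 ?leq_subr //=.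
  by rewrite mulr_natl.
have lein : (i <= n)%N by rewrite -ltnS.
by rewrite coef_deriv !fps_trunc_coef ?ltnS ?leq_subr ?le_n_n1 //= mulr_natl.
Qed.

Lemma fps_derivXS f k :
  fps_deriv (f ^+ k.+1) = (f ^+ k * fps_deriv f) *+ k.+1.
Proof.
elim: k => [|k IHk]; first by rewrite mul1r.
rewrite exprS fps_derivM IHk mulrnAr mulrA -exprS [LHS]addrC mulrC.
by rewrite -mulrSr mulrC.
Qed.

Lemma fps_coef_varX k n : ((fps_var : fps R) ^+ k) n = (n == k)%:R.
Proof.
elim: k n => [|k IHk] n //.
rewrite exprS fps_coefM; case: n => [|n].
  by rewrite big_ord1 mul0r.
rewrite big_ord_recl mul0r add0r big_ord_recl mul1r IHk subSS subn0 eqSS.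
by rewrite big1 ?addr0 // => i _; rewrite mul0r.
Qed.

Lemma fps_coef_exp_var a n : fps_exp (a *: fps_var) n = a ^+ n / n`!%:R.
Proof.
rewrite /fps_exp /= big_ord_recr /= big1 ?add0r => [|i _].
  by rewrite fps_scaleX fps_coefZ fps_coef_varX eqxx mulr1 mul1r mulrC.
by rewrite fps_scaleX fps_coefZ fps_coef_varX gtn_eqF ?mulr0.
Qed.

Lemma fps_coef_expZ_mul a e f n : f 0%N = 0 ->
  (e * fps_exp (a *: f)) n =
    \sum_(k < n.+1) (e * f ^+ k) n / k`!%:R * a ^+ k.
Proof.
move=> f0; rewrite fps_coefM.
transitivity (\sum_(i < n.+1) \sum_(k < n.+1)
    (e i * (f ^+ k) (n - i)%N / k`!%:R * a ^+ k)); last first.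
  rewrite exchange_big; apply: eq_bigr => k _.
  by rewrite fps_coefM !mulr_suml.
apply: eq_bigr => i _; rewrite /fps_exp /= mulr_sumr.
(* The exponential stops at k = n - i; to exchange the sums, this is widened to a bound free of i.
   The added terms vanish because [f ^+ k] has order at least k. *)
rewrite (big_ord_widen n.+1
  (fun k => e i * (1 / k`!%:R * ((a *: f) ^+ k) (n - i)%N))); last first.
  by rewrite ltnS leq_subr.
rewrite big_mkcond; apply: eq_bigr => k _; case: ifPn => [_|].
  by rewrite fps_scaleX fps_coefZ; ring.
by rewrite -leqNgt => lek; rewrite (@fps_coefX_lt _ f) // mulr0 !mul0r.
Qed.

End Derivative.

Section WhitneyGeneratingFunction.
Variables (R : realType) (a : R).
Hypothesis a_neq0 : a != 0.

Local Notation e := (fps_exp (@fps_var R)).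
Local Notation u := (a^-1 *: (fps_exp (a *: @fps_var R) - 1)).

Lemma fps_deriv_exp_var (b : R) :
  fps_deriv (fps_exp (b *: fps_var)) = b *: fps_exp (b *: fps_var).
Proof.
apply/fpsP => n; rewrite fps_coefZ fps_coef_deriv !fps_coef_exp_var exprS factS natrM.
by field; rewrite nat1r !pnatr_eq0 -lt0n fact_gt0.
Qed.

Let deriv_e : fps_deriv e = e.
Proof. by rewrite -[fps_var]scale1r fps_deriv_exp_var !scale1r. Qed.

Lemma fps_expB1_coef0 : u 0%N = 0.
Proof.
by rewrite fps_coefZ fps_coefB fps_coef_exp_var fps_coef1 divr1 subrr mulr0.
Qed.

(** Both sides are e^(a t). *)
Let deriv_u : fps_deriv u = 1 + a *: u.
Proof.
rewrite scalerA divff // scale1r [RHS]addrC subrK.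
apply/fpsP => n; rewrite fps_coef_deriv fps_coefZ fps_coefB fps_coef1 subr0.
by rewrite mulrCA -fps_coef_deriv fps_deriv_exp_var fps_coefZ mulKf.
Qed.

(** The candidate for W(n, k) once [a] is lambda m; lambda and m enter only through this product. *)
Definition whitney_egf_coef n k : R := n`!%:R * ((e * u ^+ k) n / k`!%:R).

Lemma whitney_egf_coef_recr0 n :
  whitney_egf_coef n.+1 0%N = whitney_egf_coef n 0%N.
Proof.
rewrite /whitney_egf_coef !divr1 !expr0 !mulr1 -[in RHS]deriv_e /=.
by rewrite mulrA -natrM mulnC -factS.
Qed.

Lemma whitney_egf_coef_recr n k :
  whitney_egf_coef n.+1 k.+1 =
    whitney_egf_coef n k + (1 + k.+1%:R * a) * whitney_egf_coef n k.+1.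
Proof.
(* Product rule with e' = e and u' = 1 + a u. Dividing by (k+1)! turns the factor k+1 on e u^k into
   1/k!. *)
have dE : fps_deriv (e * u ^+ k.+1) =
    e * u ^+ k.+1 + (e * u ^+ k + a *: (e * u ^+ k.+1)) *+ k.+1.
  rewrite fps_derivM deriv_e fps_derivXS deriv_u mulrnAr mulrA mulrDr mulr1.
  by rewrite -fps_scalerAr -mulrA -exprSr.
have /fpsP /(_ n) := dE.
rewrite fps_coef_deriv fps_coefD fps_coefMn fps_coefD fps_coefZ => dEn.
rewrite /whitney_egf_coef [n.+1`!]factS mulnC natrM -mulrA [n.+1%:R * _]mulrA.
rewrite dEn factS natrM.
by field; rewrite nat1r !pnatr_eq0 -lt0n fact_gt0.
Qed.

(** Since u has no constant term, e u^k starts at t^k or later. *)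
Lemma whitney_egf_coef_gt n k : (n < k)%N -> whitney_egf_coef n k = 0.
Proof.
move=> nk; rewrite /whitney_egf_coef fps_coefM big1 ?mul0r ?mulr0 // => i _.
by rewrite fps_coefX_lt ?mulr0 ?fps_expB1_coef0 // (leq_ltn_trans (leq_subr _ _)).
Qed.

End WhitneyGeneratingFunction.

Lemma fallingS (R : realType) (lambda : R) k :
  falling lambda k.+1 = falling lambda k * ('X - (k%:R * lambda)%:P).
Proof. by rewrite /falling big_ord_recr. Qed.

Lemma whitney_egf_coefP (R : realType) (lambda : R) m :
  lambda * m%:R != 0 ->
  is_whitney2 m lambda (whitney_egf_coef R (lambda * m%:R)).
Proof.
set a := lambda * m%:R => a0; set V := whitney_egf_coef R a.
elim=> [|n IHn].
  rewrite big_ord1 /V /whitney_egf_coef /falling big_ord0 !expr0 !mulr1.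
  by rewrite -[fps_var]scale1r fps_coef_exp_var !divr1 expr0 mul1r scale1r.
rewrite exprS IHn mulr_sumr [RHS]big_ord_recl /=.
have Vnn : V n n.+1 = 0 by exact: whitney_egf_coef_gt.
have -> : V n.+1 0%N = V n 0%N by exact: whitney_egf_coef_recr0.
under [in RHS]eq_bigr => k _ do
  rewrite /bump add1n /V whitney_egf_coef_recr // -/V mulrDl scalerDl.
rewrite big_split /= addrCA.
(* Shift of index: the isolated term has weight 1 = 1 + 0 a, so it becomes the term k = 0, and the
   top term dies by [Vnn]. *)
have -> : (V n 0%N * m%:R ^+ 0%N) *: falling lambda 0%N + \sum_(k < n.+1)
    ((1 + k.+1%:R * a) * V n k.+1 * m%:R ^+ k.+1) *: falling lambda k.+1
  = \sum_(k < n.+1)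
    ((1 + k%:R * a) * V n k * m%:R ^+ k) *: falling lambda k.
  rewrite big_ord_recr /= Vnn mulr0 mul0r scale0r addr0.
  by rewrite [in RHS]big_ord_recl mul0r addr0 mul1r.
rewrite -big_split; apply: eq_bigr => k _ /=.
(* Termwise, this is m x + 1 = m (x - k lambda) + (1 + k a). *)
rewrite fallingS exprS.
by rewrite /a -!mul_polyC !(polyCM, polyCD) polyC1; ring.
Qed.

Theorem theorem10 (R : realType) (lambda : R) (hlambda : lambda != 0)
    (m : nat) (hm : (1 <= m)%N)
    (W : nat -> nat -> R) (hW : is_whitney2 m lambda W) (x : R) :
  fps_exp fps_var *
    fps_exp (x *: ((lambda * m%:R)^-1 *:
                     (fps_exp ((lambda * m%:R) *: fps_var) - 1)))
  = fps_egf (fun n => dowling W n x).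
Proof.
have m0 : m%:R != 0 :> R by rewrite pnatr_eq0 -lt0n.
have hV := whitney_egf_coefP R lambda m (mulf_neq0 hlambda m0).
apply/fpsP => n; rewrite fps_coef_expZ_mul ?fps_expB1_coef0 //.
transitivity (dowling W n x / n`!%:R) => //.
rewrite mulr_suml; apply: eq_bigr => k _.
(* Uniqueness holds for k <= n only, which is the range summed in [dowling]. *)
rewrite (whitney2_unique hm hW hV) ?leq_ord // /whitney_egf_coef.
by field; rewrite !pnatr_eq0 -!lt0n !fact_gt0.
Qed.
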